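(* Let $\mathcal{M}=(Q,A,\tau)$ be a reversible Mealy automaton and let $P_{\mathcal{M}}$ be the semigroup generated by $\mathcal{M}$. Then $P_{\mathcal{M}}$ contains a nonabelian free subsemigroup if and only if $P_{\mathcal{M}}$ contains an element of infinite order.
   Context: A Mealy automaton is a tuple $\mathcal{M}=(Q,A,\tau)$ where $Q$ (states) and $A$ (alphabet) are finite sets and $\tau\colon Q\times A\to A\times Q$ is a map; write $\tau(q,a)=(q\cdot a,\,q@a)$. It is reversible if for every $a\in A$ the map $Q\to Q$, $q\mapsto q@a$, is a bijection. $Q^*$ and $A^*$ denote the free monoids (finite words, with empty word $\epsilon$). The operations extend uniquely to a left action $\cdot$ of $Q^*$ on the set $A^*$ and a right action $@$ of $A^*$ on the set $Q^*$ by: $s\cdot\epsilon=\epsilon$, $s@\epsilon=s$, $\epsilon\cdot u=u$, $\epsilon@u=\epsilon$, $s\cdot(uv)=(s\cdot u)\,((s@u)\cdot v)$, $s@(uv)=(s@u)@v$, $(st)\cdot u=s\cdot(t\cdot u)$, $(st)@u=(s@(t\cdot u))\,(t@u)$ for $s,t\in Q^*$, $u,v\in A^*$. For $s,t\in Q^*$ write $s\stackrel{Q}{\sim}t$ if $s\cdot u=t\cdot u$ for all $u\in A^*$; this is a congruence and $P_{\mathcal{M}}=Q^*/{\stackrel{Q}{\sim}}$ is the semigroup generated by $\mathcal{M}$ (the automaton semigroup). A nonabelian free subsemigroup means a free subsemigroup of rank two, i.e. one freely generated by two elements. An element has infinite order if its positive powers are pairwise distinct. *)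

(* Defs.v *)
From HB Require Import structures.
From mathcomp Require Import all_boot.
From mathcomp Require Import boolp.

Set Implicit Arguments.
Unset Strict Implicit.
Unset Printing Implicit Defensive.

Local Open Scope group_scope.
Local Open Scope quotient_scope.

(* [M (q, a) = (q . a, q @ a)] *)
Definition mealy (Q A : finType) := Q * A -> A * Q.

Section Mealy.

Variables (Q A : finType) (M : mealy Q A).

Definition dot1 (q : Q) (a : A) : A := (M (q, a)).1.
Definition at1 (q : Q) (a : A) : Q := (M (q, a)).2.

Definition reversible : Prop := forall a : A, bijective (at1^~ a).

Fixpoint dotq (q : Q) (u : seq A) : seq A :=
  if u is a :: v then dot1 q a :: dotq (at1 q a) v else [::].

Definition atq (q : Q) (u : seq A) : Q := foldl at1 q u.

Definition dot (s : seq Q) (u : seq A) : seq A := foldr dotq u s.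

Fixpoint at_ (s : seq Q) (u : seq A) : seq Q :=
  if s is q :: t then atq q (dot t u) :: at_ t u else [::].

(* The identities that characterise the extension of [M] to words. *)

Lemma dot_letter q a : dot [:: q] [:: a] = [:: dot1 q a].
Proof. by []. Qed.

Lemma at_letter q a : at_ [:: q] [:: a] = [:: at1 q a].
Proof. by []. Qed.

Lemma dot_nilr s : dot s [::] = [::].
Proof. by elim: s => //= q s ->. Qed.

Lemma at_nilr s : at_ s [::] = s.
Proof. by elim: s => //= q s ->; rewrite dot_nilr. Qed.

Lemma dot_nill u : dot [::] u = u.
Proof. by []. Qed.

Lemma at_nill u : at_ [::] u = [::].
Proof. by []. Qed.

Lemma dot_catl s t u : dot (s ++ t) u = dot s (dot t u).
Proof. exact: foldr_cat. Qed.

Lemma at_catl s t u : at_ (s ++ t) u = at_ s (dot t u) ++ at_ t u.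
Proof. by elim: s => //= q s ->; rewrite dot_catl. Qed.

Lemma dotq_cat q u v : dotq q (u ++ v) = dotq q u ++ dotq (atq q u) v.
Proof. by elim: u q => //= a u IHu q; rewrite IHu. Qed.

Lemma dot_catr s u v : dot s (u ++ v) = dot s u ++ dot (at_ s u) v.
Proof. by elim: s => //= q s ->; rewrite dotq_cat. Qed.

Lemma at_catr s u v : at_ s (u ++ v) = at_ (at_ s u) v.
Proof. by elim: s => //= q s ->; rewrite dot_catr /atq foldl_cat. Qed.

Definition state_equiv (s t : seq Q) : Prop := forall u, dot s u = dot t u.

Definition state_eqb (s t : seq Q) : bool := `[< state_equiv s t >].

Lemma state_eqb_refl : reflexive state_eqb.
Proof. by move=> s; apply/asboolP. Qed.

Lemma state_eqb_sym : symmetric state_eqb.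
Proof. by move=> s t; apply/asboolP/asboolP => st u; rewrite st. Qed.

Lemma state_eqb_trans : transitive state_eqb.
Proof.
by move=> t s r /asboolP st /asboolP tr; apply/asboolP => u; rewrite st tr.
Qed.

Canonical state_equiv_rel :=
  EquivRel state_eqb state_eqb_refl state_eqb_sym state_eqb_trans.

(* The quotient [P_M]; as [Q^*] contains the empty word, it has a unit. *)
Definition automaton_semigroup := {eq_quot state_equiv_rel}.
HB.instance Definition _ := Choice.on automaton_semigroup.
HB.instance Definition _ := EqQuotient.on automaton_semigroup.

Definition as_class (s : seq Q) : automaton_semigroup := \pi s.

Lemma as_classP s t : as_class s = as_class t <-> state_equiv s t.
Proof.
by split=> [/eqmodP/asboolP|st] //; apply/eqmodP/asboolP.
Qed.

Lemma as_class_repr (x : automaton_semigroup) : as_class (repr x) = x.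
Proof. exact: reprK. Qed.

Definition as_one : automaton_semigroup := as_class [::].
Definition as_mul (x y : automaton_semigroup) : automaton_semigroup :=
  as_class (repr x ++ repr y).

Lemma as_mulE s t : as_mul (as_class s) (as_class t) = as_class (s ++ t).
Proof.
apply/as_classP => u; rewrite !dot_catl.
have /as_classP -> := as_class_repr (as_class s).
by have /as_classP -> := as_class_repr (as_class t).
Qed.

Lemma as_mulA : associative as_mul.
Proof.
move=> x y z; rewrite -[x]as_class_repr -[y]as_class_repr -[z]as_class_repr.
by rewrite !as_mulE catA.
Qed.

Lemma as_mul1 : left_id as_one as_mul.
Proof. by move=> x; rewrite -[x]as_class_repr as_mulE. Qed.

Lemma as_mulr1 : right_id as_one as_mul.
Proof. by move=> x; rewrite -[x]as_class_repr as_mulE cats0. Qed.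

HB.instance Definition _ :=
  isMonoid.Build automaton_semigroup as_mulA as_mul1 as_mulr1.

End Mealy.

Section Semigroup.

Variable G : monoidType.

(* Nonempty words over [bool] are the elements of the free semigroup of rank
   two: the homomorphism from it to [G] sending the generators to [x] and [y]
   is injective. *)
Definition freely_generate (x y : G) : Prop :=
  forall w w' : seq bool, w != [::] -> w' != [::] ->
    \prod_(b <- w) (if b then x else y) = \prod_(b <- w') (if b then x else y) ->
    w = w'.

Definition contains_nonabelian_free_subsemigroup : Prop :=
  exists x y : G, freely_generate x y.

Definition infinite_order (x : G) : Prop :=
  forall m n : nat, 0 < m -> 0 < n -> x ^+ m = x ^+ n -> m = n.

End Semigroup.

(* Main.v *)
Require Import Defs.
From mathcomp Require Import all_boot.
From mathcomp Require Import boolp.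

Set Implicit Arguments.
Unset Strict Implicit.
Unset Printing Implicit Defensive.

(** A free generator has infinite order, so only one direction has content.
Let the class of a word s have infinite order. Replacing the letters by the
words of length |s|, one may assume that s is a single letter q
([power_mealy]).

The idea is to count. Reversibility makes every input word u permute the words
of each length through w |-> w @ u, so that the words that can be reached from
q^n, n any natural number, form a language ([orb]) which is closed under
factors and on each length of which the inputs act transitively. Any quantity
attached to a word of this language and invariant under the inputs therefore
depends on lengths only.

The number of letters that extend a word of length n to the left is such a
quantity; it decreases with n, hence is constant from some length N on, and
then the possible left extensions of a word are decided by its first N letters
([left_exts_take]): the language consists of the paths of a finite graph.

Identify two words of the language when they have the same length, the same
first N letters, and equivalent remaining parts ([sim]). This relation is
invariant under the inputs and, thanks to the common first letters, is
preserved by left extension. For a word w with suffix z, count the letters b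
such that some word ending in bz is identified with w ([rereads]). This number
depends only on the lengths of z and w; it increases when w is extended to the
left, and also when w and z are extended together to the right. So it takes a
constant value rho as soon as z has length at least n0 and the rest of w length
at least K.

If rho is the number of all left extensions of z, then w may be rewritten from
the right by letters chosen once and for all, up to its first K letters. So the
number of classes of words reachable from q^n is bounded
([canonical_representative]), the powers of q are given by automata of bounded
size, and two of them agree ([equiv_of_bounded_orbits]), a contradiction.

Otherwise there is, at each step, a left extension which is excluded for a given
w. Monotonicity and constancy together show that being excluded is a local
condition ([sim_local]): it is not affected by what stands to the left of the
last K letters read, nor by what stands to the right of z. As only finitely many
words of length K have to be considered, any word p of length n0 has two left
extensions x p and y p, with x and y of the same length, such that no word
ending in x p is identified with one ending in y p ([escape_threads]). If p is
chosen recurrent, x and y can be extended further to the left until p comes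
back, that is, closed up into loops at p ([balanced_loops]). Two products of these
loops that have the same length and first differ, from the right, at some factor
are then inequivalent, and [free_of_balanced_injective] gets rid of the
condition on the length. *)

(** * Words acting on words *)

Section Words.

Variables (Q A : finType) (M : mealy Q A).
Implicit Types (q : Q) (s t : seq Q) (u : seq A).

Lemma size_dotq q u : size (dotq M q u) = size u.
Proof. by elim: u q => //= a u IHu q; rewrite IHu. Qed.

Lemma size_dot s u : size (dot M s u) = size u.
Proof. by elim: s => //= q s IHs; rewrite size_dotq. Qed.

Lemma size_at s u : size (at_ M s u) = size s.
Proof. by elim: s => //= q s ->. Qed.

Lemma state_equiv_sym s t : state_equiv M s t -> state_equiv M t s.
Proof. by move=> st u; rewrite st. Qed.

Lemma state_equiv_trans s t r :
  state_equiv M s t -> state_equiv M t r -> state_equiv M s r.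
Proof. by move=> st tr u; rewrite st. Qed.

Lemma state_equiv_cat s s' t t' :
  state_equiv M s s' -> state_equiv M t t' -> state_equiv M (s ++ t) (s' ++ t').
Proof. by move=> ss tt u; rewrite !dot_catl tt. Qed.

Lemma state_equiv_at s t u :
  state_equiv M s t -> state_equiv M (at_ M s u) (at_ M t u).
Proof.
move=> st v; have := st (u ++ v); rewrite !dot_catr st => /eqP.
by rewrite eqseq_cat // eqxx => /eqP.
Qed.

Lemma take_at n s u : take n (at_ M s u) = at_ M (take n s) (dot M (drop n s) u).
Proof.
have [le_s_n|lt_n_s] := leqP (size s) n.
  by rewrite !take_oversize ?size_at // drop_oversize.
rewrite -{1}(cat_take_drop n s) at_catl take_size_cat //.
by rewrite size_at size_takel // ltnW.
Qed.

Lemma drop_at n s u : drop n (at_ M s u) = at_ M (drop n s) u.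
Proof.
have [le_s_n|lt_n_s] := leqP (size s) n.
  by rewrite !drop_oversize ?size_at.
rewrite -{1}(cat_take_drop n s) at_catl drop_size_cat //.
by rewrite size_at size_takel // ltnW.
Qed.

End Words.

(** * Powers of an automaton *)

Section Power.

Variables (Q A : finType) (M : mealy Q A) (L : nat).

(** A word of length L becomes a single letter with the same action. The default
values stand for impossible cases, as both actions preserve lengths. *)
Definition power_mealy : mealy (L.-tuple Q) A :=
  fun ta => (head ta.2 (dot M ta.1 [:: ta.2]),
             insubd ta.1 (at_ M ta.1 [:: ta.2])).

Lemma val_at1_power t a : val (at1 power_mealy t a) = at_ M t [:: a].
Proof. by rewrite /at1 /= insubdK // -topredE /= size_at size_tuple. Qed.

Lemma dotq_power t u : dotq power_mealy t u = dot M t u.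
Proof.
elim: u t => [|a u IHu] t; first by rewrite dot_nilr.
rewrite -cat1s dot_catr /= IHu val_at1_power /dot1 /=.
by case: (dot M t [:: a]) (size_dot M t [:: a]) => [|b [|]].
Qed.

Lemma dot_power (s : seq (L.-tuple Q)) u :
  dot power_mealy s u = dot M (flatten (map val s)) u.
Proof. by elim: s => //= t s IHs; rewrite dot_catl dotq_power IHs. Qed.

End Power.

Arguments power_mealy {Q A} M L.

(** * Reversible automata *)

Section Reversible.

Variables (Q A : finType) (M : mealy Q A).
Hypothesis reversibleM : reversible M.
Implicit Types (q : Q) (s t : seq Q) (u : seq A).

Lemma atq_inj u : injective (atq M ^~ u).
Proof.
elim: u => [|a u IHu] q q' //= /IHu.
by apply: (bij_inj (reversibleM a)).
Qed.

Lemma at_inj u s t : at_ M s u = at_ M t u -> s = t.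
Proof.
elim: s t => [|q s IHs] [|q' t] //= [] eqq /IHs eqs.
by move: eqq; rewrite eqs => /atq_inj ->.
Qed.

Lemma power_reversible L : reversible (power_mealy M L).
Proof.
move=> a; apply: injF_bij => t t' eqt; apply: val_inj.
by apply: (@at_inj [:: a]); rewrite -!val_at1_power eqt.
Qed.

(** Each input letter permutes the finitely many words of a given length, so
some power of it undoes its action. *)
Lemma at_return s u : exists u', at_ M (at_ M s u) u' = s.
Proof.
elim: u s => [|a u IHu] s; first by exists [::]; rewrite !at_nilr.
have [u' at_u'] := IHu (at_ M s [:: a]).
pose f := at1 (power_mealy M (size s)) ^~ a.
have f_inj : injective f by apply: bij_inj; apply: power_reversible.
have valf k (t : (size s).-tuple Q) : val (iter k f t) = at_ M t (nseq k a).
  elim: k => [|k IHk]; first by rewrite at_nilr.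
  by rewrite -addn1 nseqD at_catr addn1 iterS val_at1_power IHk.
have := iter_order f_inj (in_tuple s).
rewrite -orderSpred iterSr => /(congr1 val); rewrite valf val_at1_power /= => at_a.
exists (u' ++ nseq (order f (in_tuple s)).-1 a).
by rewrite -[a :: u]cat1s !at_catr at_u'.
Qed.

End Reversible.

(** * Bounded orbits *)

Section FinitelyManyClasses.

Variables (Q A : finType) (M : mealy Q A).

(** If for every m the words reachable from [s m] fall into at most |I|
classes, then the action of [s m] is that of an automaton with state set I.
There are finitely many such automata, so two of them coincide. *)
Lemma equiv_of_bounded_orbits (I : finType) (g : nat -> I -> seq Q)
    (s : nat -> seq Q) :
    (forall m u, exists i, state_equiv M (at_ M (s m) u) (g m i)) ->
  exists m n, m <> n /\ state_equiv M (s m) (s n).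
Proof.
move=> gP.
have [init initP] : {init : nat -> I & forall m, state_equiv M (s m) (g m (init m))}.
  apply: (boolp.choice (P := fun m i => state_equiv M (s m) (g m i))) => m.
  by have [i] := gP m [::]; rewrite at_nilr; exists i.
pose next m i a : I :=
  odflt i [pick j | `[< state_equiv M (at_ M (g m i) [:: a]) (g m j) >]].
pose code m : I * {ffun I * A -> I * A} :=
  (init m, [ffun ia => (next m ia.1 ia.2, head ia.2 (dot M (g m ia.1) [:: ia.2]))]).
(* The code of m is an automaton on I, with initial state, that computes the
   action of [s m]. *)
have [m [n [neq_mn eq_code]]] : exists m n, m <> n /\ code m = code n.
  pose T : finType := (I * {ffun I * A -> I * A})%type.
  pose c (k : 'I_#|T|.+1) : T := code k.
  have : ~~ injectiveb c.
    by apply/negP => /injectiveP /leq_card; rewrite card_ord ltnn.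
  case/injectivePn => m [n neq_mn eq_c].
  by exists m, n; split=> // eq_mn; rewrite (val_inj eq_mn) eqxx in neq_mn.
exists m, n; split=> //.
have nextP k i v : state_equiv M (at_ M (s k) v) (g k i) ->
    forall a, state_equiv M (at_ M (g k i) [:: a]) (g k (next k i a))
           /\ state_equiv M (at_ M (s k) (v ++ [:: a])) (g k (next k i a)).
  move=> vi a.
  have vai : state_equiv M (at_ M (s k) (v ++ [:: a])) (at_ M (g k i) [:: a]).
    by rewrite at_catr; apply: state_equiv_at.
  suff : state_equiv M (at_ M (g k i) [:: a]) (g k (next k i a)).
    by move=> ia; split=> //; apply: state_equiv_trans ia.
  rewrite /next; case: pickP => [j /asboolP //|] noj.
  have [j vj] := gP k (v ++ [:: a]).
  have /asboolP[] := noj j.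
  by apply: state_equiv_trans vj; apply: state_equiv_sym.
have [eq_init /ffunP eq_tr] : code m = code n := eq_code.
(* The words v and w witness that the state i is reachable, where alone
   [next] is known to be correct. *)
have eq_dot u i v w : state_equiv M (at_ M (s m) v) (g m i) ->
    state_equiv M (at_ M (s n) w) (g n i) -> dot M (g m i) u = dot M (g n i) u.
  elim: u i v w => [|a u IHu] i v w vi wi; first by rewrite !dot_nilr.
  have [ma /IHu mu] := nextP _ _ _ vi a; have [na nu] := nextP _ _ _ wi a.
  have := eq_tr (i, a); rewrite !ffunE /= => -[eq_next eq_out].
  rewrite -[a :: u]cat1s !dot_catr ma na eq_next; congr (_ ++ _); last first.
    by rewrite -eq_next (mu (w ++ [:: a])) eq_next.
  move: eq_out; have := size_dot M (g m i) [:: a].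
  have := size_dot M (g n i) [:: a].
  by case: dot => [|b []] //; case: dot => [|b' []] //= _ _ ->.
move=> u; rewrite (initP m) (initP n) eq_init.
apply: (eq_dot _ _ [::] [::]); rewrite at_nilr //.
by rewrite -eq_init.
Qed.

End FinitelyManyClasses.

(** * A criterion for freeness *)

Definition word (T : Type) (X Y : seq T) (w : seq bool) : seq T :=
  flatten [seq if b then X else Y | b <- w].

Lemma word_cons T (X Y : seq T) b w :
  word X Y (b :: w) = (if b then X else Y) ++ word X Y w.
Proof. by []. Qed.

Lemma word_cat T (X Y : seq T) w w' :
  word X Y (w ++ w') = word X Y w ++ word X Y w'.
Proof. by rewrite /word map_cat flatten_cat. Qed.

Section FreeCriterion.

Variables (G : monoidType) (x y : G).

Local Notation eval w := (\prod_(b <- w) (if b then x else y))%g.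

Lemma suffix_dichotomy (w w' : seq bool) : w <> w' ->
  [\/ exists v v' b u, w = v ++ b :: u /\ w' = v' ++ ~~ b :: u,
      exists v b, w' = v ++ b :: w | exists v b, w = v ++ b :: w'].
Proof.
elim/last_ind: w w' => [|w b IHw] w'.
  case/lastP: w' => // w' b _; apply: Or32.
  by exists w', b; rewrite cats1.
case/lastP: w' => [_|w' b' neq].
  by apply: Or33; exists w, b; rewrite cats1.
have [eqb|neqb] := eqVneq b b'; last first.
  apply: Or31; exists w, w', b, [::]; rewrite !cats1; split=> //.
  by congr rcons; case: b b' neqb {neq} => [] [].
rewrite -eqb in neq *; have /IHw : w <> w' by move=> eqw; rewrite eqw in neq.
case=> [[v [v' [c [u [-> ->]]]]]|[v [c ->]]|[v [c ->]]].
- by apply: Or31; exists v, v', c, (rcons u b); rewrite !rcons_cat.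
- by apply: Or32; exists v, c; rewrite rcons_cat.
- by apply: Or33; exists v, c; rewrite rcons_cat.
Qed.

(** It suffices to separate words that contain each generator equally often.
Indeed, if w and w' differ at a letter when compared from the right and have
equal values, then so have w'w and ww', which differ at the same place and are
balanced. If instead w is a proper suffix of w', say with the letter b before
it in w', then multiplying both on the left by the other letter leads back to
the first case. *)
Lemma free_of_balanced_injective :
    (forall v v' u, perm_eq (rcons v true) (rcons v' false) ->
       eval (v ++ true :: u) <> eval (v' ++ false :: u)) ->
  freely_generate x y.
Proof.
move=> balanced.
have branch v v' b u : eval (v ++ b :: u) <> eval (v' ++ ~~ b :: u).
  wlog -> : v v' b / b = true.
    case: b => IH; first exact: IH.
    by move=> /esym; apply: (IH _ _ true).
  move=> /= eq_e; set w := v ++ true :: u in eq_e; set w' := v' ++ _ in eq_e.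
  apply: (balanced (w' ++ v) (w ++ v') u); last first.
    by rewrite -catA -/w -(catA w) -/w' [LHS]big_cat [RHS]big_cat /= eq_e.
  rewrite -(perm_cat2r u) !cat_rcons -catA -/w -(catA w) -/w'.
  by rewrite perm_catC.
have tail v b w : eval w <> eval (v ++ b :: w).
  move=> eq_e; apply: (branch [::] (~~ b :: v) (~~ b) w).
  by rewrite negbK /= !big_cons eq_e.
move=> w w' _ _ eq_e; apply: contrapT => /suffix_dichotomy[].
- by move=> [v [v' [b [u [eqw eqw']]]]]; apply: (branch v v' b u); rewrite -eqw -eqw'.
- by move=> [v [b eqw']]; apply: (tail v b w); rewrite -eqw'.
- by move=> [v [b eqw]]; apply: (tail v b w'); rewrite -eqw.
Qed.

End FreeCriterion.

(** * The language of a letter *)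

Lemma monotone_bounded_stabilises (f : nat -> nat -> nat) (B : nat) :
    (forall k n, f k n <= B) ->
    (forall k k' n n', k <= k' -> n <= n' -> f k n <= f k' n') ->
  exists K n0, forall k n, K <= k -> n0 <= n -> f k n = f K n0.
Proof.
move=> fB f_mono; pose P r := `[< exists k n, f k n = r >].
have exP : exists r, P r by exists (f 0 0); apply/asboolP; exists 0, 0.
have PB r : P r -> r <= B by move=> /asboolP[k [n <-]].
case: (ex_maxnP exP PB) => r /asboolP[K [n0 <-]] max_r; exists K, n0.
move=> k n leK len; apply/eqP; rewrite eqn_leq (f_mono K k n0 n) // andbT.
by apply: max_r; apply/asboolP; exists k, n.
Qed.

Section Orbit.

Variables (Q A : finType) (M : mealy Q A) (q : Q).
Hypothesis reversibleM : reversible M.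
Implicit Types (b : Q) (p s t v w x y z : seq Q) (u : seq A).

Definition orb w := exists u, at_ M (nseq (size w) q) u = w.

Lemma orb_nseq n : orb (nseq n q).
Proof. by exists [::]; rewrite at_nilr size_nseq. Qed.

(** This is why all counts below depend on lengths only. *)
Lemma orb_transitive w w' :
  orb w -> orb w' -> size w = size w' -> exists u, at_ M w u = w'.
Proof.
move=> [u uw] [u' uw'] eq_sz.
have [r] := at_return reversibleM (nseq (size w) q) u; rewrite uw => rw.
by exists (r ++ u'); rewrite at_catr rw eq_sz.
Qed.

Lemma orb_cat v w : orb (v ++ w) -> orb v /\ orb w.
Proof.
move=> [u]; rewrite size_cat nseqD at_catl => /eqP.
rewrite eqseq_cat ?size_at ?size_nseq // => /andP[/eqP vP /eqP wP].
by split; eexists; eassumption.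
Qed.

Lemma orb_prefix v w : orb (v ++ w) -> orb v.
Proof. by case/orb_cat. Qed.

Lemma orb_suffix v w : orb (v ++ w) -> orb w.
Proof. by case/orb_cat. Qed.

Lemma orb_at w u : orb w -> orb (at_ M w u).
Proof. by move=> [u' <-]; exists (u' ++ u); rewrite at_catr !size_at size_nseq. Qed.

Definition left_exts w := [set b | `[< orb (b :: w) >]].

Lemma left_extsP b w : reflect (orb (b :: w)) (b \in left_exts w).
Proof. by rewrite inE; apply: asboolP. Qed.

(** The input u sends bz to (b @ (z . u))(z @ u), and b |-> b @ (z . u) is
injective. *)
Lemma card_left_exts w :
  orb w -> #|left_exts w| = #|left_exts (nseq (size w) q)|.
Proof.
have le_at z u : #|left_exts z| <= #|left_exts (at_ M z u)|.
  rewrite -(card_imset _ (atq_inj reversibleM (u := dot M z u))).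
  apply/subset_leq_card/subsetP => _ /imsetP[b /left_extsP/(orb_at u) bz ->].
  exact/left_extsP.
move=> w_orb; apply/eqP; rewrite eqn_leq.
have sz_w : size w = size (nseq (size w) q) by rewrite size_nseq.
have [u uw] := orb_transitive w_orb (orb_nseq _) sz_w.
have [u' u'w] := orb_transitive (orb_nseq _) w_orb (esym sz_w).
have := le_at w u; have := le_at (nseq (size w) q) u'.
by rewrite uw u'w => -> ->.
Qed.

Lemma left_exts_stabilise :
  exists N, forall n, N <= n -> left_exts (nseq n q) = left_exts (nseq N q).
Proof.
have decr m n : m <= n -> left_exts (nseq n q) \subset left_exts (nseq m q).
  move=> le_mn; apply/subsetP => b /left_extsP.
  rewrite -(subnKC le_mn) nseqD -cat_cons => /orb_prefix.
  by move/left_extsP.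
have [|k k' n n' _ le_n|K [N stable]] :=
    @monotone_bounded_stabilises (fun _ n => #|~: left_exts (nseq n q)|) #|Q|.
- by move=> _ n; apply: max_card.
- by apply: subset_leq_card; rewrite setCS decr.
exists N => n le_Nn; apply/eqP; rewrite eqEcard decr //=.
rewrite -(leq_add2r #|~: left_exts (nseq n q)|) cardsC.
by rewrite (stable _ _ (leqnn K) le_Nn) cardsC.
Qed.

Section FiniteType.

Variable N : nat.
Hypothesis stableN :
  forall n, N <= n -> left_exts (nseq n q) = left_exts (nseq N q).

Lemma card_left_exts_stable w :
  orb w -> N <= size w -> #|left_exts w| = #|left_exts (nseq N q)|.
Proof. by move=> /card_left_exts -> /stableN ->. Qed.

(** The left extensions of w are among those of its prefix of length N, and
there are equally many of them. *)
Lemma left_exts_take w :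
  orb w -> N <= size w -> left_exts w = left_exts (take N w).
Proof.
move=> w_orb le_N; have take_orb : orb (take N w).
  by apply: (@orb_prefix _ (drop N w)); rewrite cat_take_drop.
apply/eqP; rewrite eqEcard !card_left_exts_stable // ?size_takel // leqnn andbT.
apply/subsetP => b /left_extsP; rewrite -{1}(cat_take_drop N w) -cat_cons.
by move=> /orb_prefix/left_extsP.
Qed.

(** The letters of v are added to the left one by one; whether this is possible
is decided by the N letters that follow ([left_exts_take]), and these do not
change when w is appended. *)
Lemma orb_glue v z w :
  orb (v ++ z) -> orb (z ++ w) -> N <= size z -> orb (v ++ z ++ w).
Proof.
move=> vz_orb zw_orb le_N; elim: v vz_orb => //= b v IHv bvz_orb.
have vz_orb : orb (v ++ z) by exact: (@orb_suffix [:: b]).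
have le_Nvz : N <= size (v ++ z) by rewrite size_cat (leq_trans le_N) ?leq_addl.
apply/left_extsP; rewrite left_exts_take; last 2 first.
- exact: IHv.
- by rewrite catA size_cat (leq_trans le_Nvz) ?leq_addr.
by rewrite catA takel_cat // -left_exts_take //; apply/left_extsP.
Qed.

Lemma orb_extend k w : orb w -> N <= size w -> exists v, size v = k /\ orb (v ++ w).
Proof.
move=> w_orb le_N; elim: k => [|k [v [sz_v vw_orb]]]; first by exists [::].
have : 0 < #|left_exts (v ++ w)|.
  rewrite card_left_exts //; apply/card_gt0P; exists q.
  exact/left_extsP/(orb_nseq _.+1).
by move=> /card_gt0P[b /left_extsP bvw]; exists (b :: v); rewrite /= sz_v.
Qed.

(** * Words of the language up to equivalence *)

(** Equivalence of words, refined so as to remember the vertex of the graph at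
which a path ends. A letter that extends a word of the language to the left
need not extend an equivalent one; but it does so if the two words have the
same first N letters. *)
Definition sim w w' :=
  [/\ size w = size w', take N w = take N w'
    & state_equiv M (drop N w) (drop N w')].

Lemma sim_refl w : sim w w.
Proof. by split. Qed.

Lemma sim_sym w w' : sim w w' -> sim w' w.
Proof. by case=> sz eqt eqd; split; last exact: state_equiv_sym. Qed.

Lemma sim_trans w2 w1 w3 : sim w1 w2 -> sim w2 w3 -> sim w1 w3.
Proof.
case=> sz eqt eqd [sz' eqt' eqd']; split; [by rewrite sz|by rewrite eqt|].
exact: state_equiv_trans eqd'.
Qed.

Lemma sim_state_equiv w w' : sim w w' -> state_equiv M w w'.
Proof.
case=> _ eqt eqd; rewrite -(cat_take_drop N w) -(cat_take_drop N w') eqt.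
exact: state_equiv_cat.
Qed.

(** The action of u on the first N letters depends only on the action on u of
the remaining ones, which is the same for equivalent words. *)
Lemma sim_at w w' u : sim w w' -> sim (at_ M w u) (at_ M w' u).
Proof.
case=> sz eqt eqd; split; rewrite ?size_at // ?take_at ?drop_at.
  by rewrite eqt eqd.
exact: state_equiv_at.
Qed.

Lemma sim_catl v w w' : sim w w' -> sim (v ++ w) (v ++ w').
Proof.
move=> [sz eqt eqd].
have eqtm m : m <= N -> take m w = take m w'.
  by move=> le_mN; rewrite -(take_takel _ le_mN) eqt take_takel.
split; first by rewrite !size_cat sz.
  by rewrite !take_cat; case: ifP => //; rewrite eqtm ?leq_subr.
rewrite !drop_cat; case: ifP => _.
  by apply: state_equiv_cat => //; apply: sim_state_equiv.
set m := N - size v.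
have [le_w'|lt_w'] := leqP (size w') N.
  by move: eqt; rewrite !take_oversize ?sz // => ->.
rewrite -(cat_take_drop N w) -(cat_take_drop N w') eqt.
rewrite !drop_cat !size_takel ?(ltnW lt_w') //.
case: ltnP => [_|le_Nm]; first exact: state_equiv_cat.
have /eqP -> : m == N by rewrite eqn_leq leq_subr.
by rewrite subnn !drop0.
Qed.

Lemma sim_catr w w' z : N <= size w -> sim w w' -> sim (w ++ z) (w' ++ z).
Proof.
move=> le_N [sz eqt eqd]; split; first by rewrite !size_cat sz.
  by rewrite !takel_cat -?sz.
rewrite -{1}(cat_take_drop N w) -{1}(cat_take_drop N w') -!catA.
by rewrite !drop_size_cat ?size_takel -?sz //; apply: state_equiv_cat.
Qed.

Lemma orb_sim_catl v w w' :
  N <= size w -> sim w w' -> orb w' -> orb (v ++ w) -> orb (v ++ w').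
Proof.
move=> le_N [sz eqt _] w'_orb; rewrite -{1}(cat_take_drop N w) catA eqt.
move=> /orb_prefix vt_orb; rewrite -(cat_take_drop N w').
by apply: orb_glue; rewrite ?cat_take_drop ?size_takel -?sz.
Qed.

(** The letters that may come next when a word identified with w is read from
the right and z has been read. *)
Definition rereads z w :=
  [set b | `[< exists v, orb (v ++ b :: z) /\ sim (v ++ b :: z) w >]].

Lemma rereadsP b z w :
  reflect (exists v, orb (v ++ b :: z) /\ sim (v ++ b :: z) w)
          (b \in rereads z w).
Proof. by rewrite inE; apply: asboolP. Qed.

Lemma rereads_sub_left_exts z w : rereads z w \subset left_exts z.
Proof.
by apply/subsetP => b /rereadsP[v [/orb_suffix bz_orb _]]; apply/left_extsP.
Qed.

Lemma rereads_sim z w w' : sim w w' -> rereads z w = rereads z w'.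
Proof.
move=> ww'; apply/setP => b; apply/rereadsP/rereadsP => -[v [v_orb vw]]; exists v.
  by split=> //; apply: sim_trans ww'.
by split=> //; apply: sim_trans vw (sim_sym ww').
Qed.

Lemma card_rereads v z : orb (v ++ z) ->
  #|rereads z (v ++ z)| =
  #|rereads (nseq (size z) q) (nseq (size v + size z) q)|.
Proof.
have le_at t w u : #|rereads t w| <= #|rereads (at_ M t u) (at_ M w u)|.
  rewrite -(card_imset _ (atq_inj reversibleM (u := dot M t u))).
  apply/subset_leq_card/subsetP => _ /imsetP[b /rereadsP[s [s_orb sw]] ->].
  apply/rereadsP; exists (at_ M s (dot M (b :: t) u)).
  rewrite -[_ :: at_ M t u]/(at_ M (b :: t) u) -at_catl.
  by split; [apply: orb_at | apply: sim_at].
move=> vz_orb; rewrite -size_cat.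
have sz_w : size (v ++ z) = size (nseq (size (v ++ z)) q) by rewrite size_nseq.
have at_suffix w w' u : at_ M w u = w' ->
    at_ M (drop (size v) w) u = drop (size v) w'.
  by rewrite -drop_at => ->.
have dropn : drop (size v) (nseq (size (v ++ z)) q) = nseq (size z) q.
  by rewrite drop_nseq size_cat addKn.
have dropz : drop (size v) (v ++ z) = z by rewrite drop_size_cat.
have [u uw] := orb_transitive vz_orb (orb_nseq _) sz_w.
have [u' u'w] := orb_transitive (orb_nseq _) vz_orb (esym sz_w).
have := at_suffix _ _ _ uw; have := at_suffix _ _ _ u'w.
rewrite dropn dropz => u'z uz; apply/eqP; rewrite eqn_leq.
have := le_at z (v ++ z) u; have := le_at (nseq (size z) q) (nseq (size (v ++ z)) q) u'.
by rewrite uw uz u'w u'z => -> ->.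
Qed.

(** A word identified with w can be substituted for w between v and x. *)
Lemma rereads_mono v w z x :
  N <= size z -> orb (z ++ x) -> orb (v ++ w ++ x) ->
  rereads z w \subset rereads (z ++ x) (v ++ w ++ x).
Proof.
move=> le_N zx_orb vwx_orb; apply/subsetP => b /rereadsP[s [sbz_orb simw]].
have le_Ns : N <= size (s ++ b :: z).
  by rewrite size_cat /= addnS -addSn (leq_trans le_N) ?leq_addl.
have sim_x : sim ((s ++ b :: z) ++ x) (w ++ x) by apply: sim_catr.
have sbzx_orb : orb ((s ++ b :: z) ++ x).
  by rewrite -cat_rcons -catA; apply: orb_glue; rewrite ?cat_rcons.
apply/rereadsP; exists (v ++ s).
have -> : (v ++ s) ++ b :: z ++ x = v ++ (s ++ b :: z) ++ x by rewrite -!catA.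
split; last exact: sim_catl.
apply: (orb_sim_catl _ (sim_sym sim_x)) => //.
case: sim_x => <- _ _; by rewrite size_cat (leq_trans le_Ns) ?leq_addr.
Qed.

Lemma card_rereads_stabilise : exists K n0 rho, N <= n0 /\
  forall k n, K <= k -> n0 <= n ->
    #|rereads (nseq n q) (nseq (k + n) q)| = rho.
Proof.
pose f k n := #|rereads (nseq (N + n) q) (nseq (k + (N + n)) q)|.
have [||K [n0 stable]] := @monotone_bounded_stabilises f #|Q|.
- by move=> k n; apply: max_card.
- move=> k k' n n' le_k le_n; apply: subset_leq_card.
  have -> : N + n' = (N + n) + (n' - n) by rewrite -addnA subnKC.
  have -> : k' + (N + n + (n' - n)) = (k' - k) + (k + (N + n) + (n' - n)).
    by rewrite !addnA subnK.
  rewrite (nseqD (N + n)) (nseqD (k' - k)) (nseqD (k + (N + n))).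
  apply: rereads_mono; rewrite -?nseqD ?size_nseq ?leq_addr //; exact: orb_nseq.
exists K, (N + n0), (f K n0); split=> [|k n le_K le_n]; first exact: leq_addr.
rewrite -(stable k (n - N)) //; last by rewrite leq_subRL // (leq_trans _ le_n) ?leq_addr.
by rewrite /f subnKC // (leq_trans _ le_n) ?leq_addr.
Qed.

(** A vertex from which as few vertices as possible can be reached is reached
again from each of those. *)
Lemma recurrent_orb n : N <= n -> exists p, [/\ size p = n, orb p &
  forall v, orb (v ++ p) -> exists v', orb (v' ++ v ++ p) /\ take n (v' ++ v ++ p) = p].
Proof.
move=> le_N; pose reach (p : n.-tuple Q) :=
  [set t : n.-tuple Q | `[< exists v, orb (v ++ p) /\ take n (v ++ p) = t >]].
pose in_orb (p : n.-tuple Q) := `[< orb p >].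
have in_orbn : in_orb (nseq_tuple n q) by apply/asboolP/orb_nseq.
have [p /asboolP p_orb min_p] := arg_minnP (fun t : n.-tuple Q => #|reach t|) in_orbn.
exists p; split=> //; first exact: size_tuple.
move=> v vp_orb; have sz_t : size (take n (v ++ p)) == n.
  by rewrite size_takel // size_cat size_tuple leq_addl.
pose t := Tuple sz_t; have t_orb : orb t.
  by apply: (@orb_prefix _ (drop n (v ++ p))); rewrite cat_take_drop.
have glue v2 : orb (v2 ++ t) ->
    orb (v2 ++ v ++ p) /\ take n (v2 ++ v ++ p) = take n (v2 ++ t).
  have vp_split : v ++ p = t ++ drop n (v ++ p) by rewrite cat_take_drop.
  move=> v2t_orb; rewrite vp_split; split.
    by apply: orb_glue; rewrite -?vp_split ?size_tuple.
  by rewrite catA takel_cat // size_cat size_tuple leq_addl.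
have sub_tp : reach t \subset reach p.
  apply/subsetP => s; rewrite !inE => /asboolP[v2 [/glue[v2_orb v2_take] v2s]].
  by apply/asboolP; exists (v2 ++ v); rewrite -catA v2_take.
have eq_tp : reach t = reach p.
  by apply/eqP; rewrite eqEcard sub_tp min_p //; apply/asboolP.
have : p \in reach t.
  by rewrite eq_tp inE; apply/asboolP; exists [::]; rewrite take_oversize ?size_tuple.
rewrite inE => /asboolP[v' [/glue[v'_orb <-] v'_p]].
by exists v'.
Qed.

(** * Two loops that generate a free semigroup *)

Section Threads.

Variables K n0 rho : nat.
Hypothesis le_N_n0 : N <= n0.
Hypothesis card_rho : forall k n, K <= k -> n0 <= n ->
  #|rereads (nseq n q) (nseq (k + n) q)| = rho.

Lemma card_rereads_rho z w v :
    n0 <= size z -> K + size z <= size w -> orb (v ++ z) -> sim (v ++ z) w ->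
  #|rereads z w| = rho.
Proof.
move=> le_z le_w vz_orb simw; rewrite -(rereads_sim _ simw) card_rereads //.
apply: card_rho => //; case: simw => sz_w _ _.
by rewrite -(leq_add2r (size z)) -size_cat sz_w.
Qed.

(** Suppose that p is known to be a suffix of a word identified with w. Then
the possible continuations of p inside words identified with w are the same as
inside words identified with v1 w x: the former are among the latter
([rereads_mono]) and both are rho in number. So a longer suffix y p that occurs
in the wide context occurs already in the narrow one. *)
Lemma sim_local y p w v0 v1 x v2 :
    n0 <= size p -> K + (size y + size p) <= size w ->
    orb (v0 ++ p) -> sim (v0 ++ p) w ->
    orb (v1 ++ w ++ x) -> orb (v2 ++ y ++ p ++ x) ->
    sim (v2 ++ y ++ p ++ x) (v1 ++ w ++ x) ->
  exists v, orb (v ++ y ++ p) /\ sim (v ++ y ++ p) w.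
Proof.
elim/last_ind: y p v0 => [|y b IHy] p v0 le_p le_w v0p_orb simw w_orb v2_orb sim_v2.
  by exists v0.
move: v2_orb sim_v2; rewrite !cat_rcons => v2_orb sim_v2.
have px_orb : orb (p ++ x).
  by apply: (@orb_suffix (v2 ++ y ++ [:: b])); rewrite -!catA.
have le_p' : K + size p <= size w.
  by rewrite (leq_trans _ le_w) // leq_add2l leq_addl.
have eq_rereads : rereads p w = rereads (p ++ x) (v1 ++ w ++ x).
  apply/eqP; rewrite eqEcard rereads_mono ?(leq_trans le_N_n0) //=.
  rewrite (card_rereads_rho le_p le_p' v0p_orb simw).
  rewrite (card_rereads_rho (v := v2 ++ y ++ [:: b])) -?catA //.
    by rewrite size_cat (leq_trans le_p) ?leq_addr.
  by rewrite !size_cat addnA (leq_trans _ (leq_addl _ _)) ?leq_add2r.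
have /rereadsP[v [v_orb simv]] : b \in rereads p w.
  by rewrite eq_rereads; apply/rereadsP; exists (v2 ++ y); rewrite -catA.
apply: (IHy (b :: p) v) => //=; first exact: leqW.
by rewrite addnS -addSn -(size_rcons y b).
Qed.

Section EverythingRereads.

Hypothesis rho_ge : #|left_exts (nseq N q)| <= rho.

Definition canonical_ext z := odflt q [pick b in left_exts z] :: z.

(** When every letter that may extend a word may also be reread, the letters of
a word to the left of z can be replaced, from the right, by any prescribed
choice, as long as K letters remain. *)
Lemma canonical_representative v z j :
    orb (v ++ z) -> n0 <= size z -> K + j <= size v ->
  exists v', orb (v' ++ iter j canonical_ext z)
          /\ sim (v' ++ iter j canonical_ext z) (v ++ z).
Proof.
move=> vz_orb le_z; have size_iter i : size (iter i canonical_ext z) = i + size z.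
  by elim: i => //= i ->.
elim: j => [|j IHj] le_v; first by exists v; split; last exact: sim_refl.
have [|v' [v'_orb simv']] := IHj; first by rewrite (leq_trans _ le_v) ?leq_add2l.
set t := iter j canonical_ext z in v'_orb simv' *.
have t_orb : orb t := orb_suffix v'_orb.
have le_t : n0 <= size t by rewrite size_iter (leq_trans le_z) ?leq_addl.
have le_w : K + size t <= size (v ++ z).
  by rewrite size_cat size_iter addnA leq_add2r (leq_trans _ le_v) ?leq_add2l.
have rereads_all : rereads t (v ++ z) = left_exts t.
  apply/eqP; rewrite eqEcard rereads_sub_left_exts.
  rewrite (card_rereads_rho le_t le_w v'_orb simv').
  by rewrite card_left_exts_stable // (leq_trans le_N_n0).
have /rereadsP[s s_ok] : odflt q [pick b in left_exts t] \in rereads t (v ++ z).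
  rewrite rereads_all; case: pickP => [//|no_ext].
  have [[|b s] [] //] := orb_extend 1 t_orb (leq_trans le_N_n0 le_t).
  case: s => // _ /left_extsP; by rewrite no_ext.
by exists s.
Qed.

(** A class is determined by the n0 last letters of a word and by the K first
ones of its canonical representative. *)
Lemma powers_equiv : exists m n,
  [/\ 0 < m, 0 < n, m <> n & state_equiv M (nseq m q) (nseq n q)].
Proof.
pose len m := m.+1 + K + n0.
pose g m (c : K.-tuple Q * n0.-tuple Q) :=
  val c.1 ++ iter m.+1 canonical_ext (val c.2).
have [m u|m [n [neq_mn equiv_mn]]] :=
    equiv_of_bounded_orbits (M := M) (g := g) (s := fun m => nseq (len m) q).
  set w := at_ M _ u; have w_orb : orb w by apply/orb_at/orb_nseq.
  have sz_w : size w = m.+1 + K + n0 by rewrite size_at size_nseq.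
  have sz_drop : size (drop (m.+1 + K) w) == n0 by rewrite size_drop sz_w addKn.
  move: w_orb sz_w; rewrite -{1 2}(cat_take_drop (m.+1 + K) w) => w_orb sz_w.
  have [||v [v_orb simv]] := canonical_representative (j := m.+1) w_orb.
  - by rewrite (eqP sz_drop).
  - rewrite addnC; move: sz_w; rewrite size_cat (eqP sz_drop) => /addIn ->; exact: leqnn.
  have sz_v : size v == K.
    have [sz_vw _ _] := simv; move: sz_vw.
    rewrite sz_w size_cat; move: (eqP sz_drop).
    have -> t j : size (iter j canonical_ext t) = j + size t.
      by elim: j => //= j ->.
    by move=> ->; rewrite addnA => /addIn; rewrite addnC => /addnI/eqP.
  exists (Tuple sz_v, Tuple sz_drop).
  rewrite -[X in state_equiv _ X _](cat_take_drop (m.+1 + K) w).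
  exact/state_equiv_sym/sim_state_equiv.
exists (len m), (len n); split=> //.
by move=> /addIn/addIn [].
Qed.

End EverythingRereads.

Hypothesis rho_lt : rho < #|left_exts (nseq N q)|.

(** Some y leads from p away from all words of the given list. Each of its
letters deals with one word w of the list: of the extensions of the part already
read, at most rho can be continued to a word identified with w, and there are
more than rho extensions. The bound on the lengths leaves K letters of w when
its turn comes. *)
Lemma escape_threads ws p :
    orb p -> n0 <= size p ->
    (forall w, w \in ws -> K + (size ws + size p) <= size w) ->
  exists y, [/\ size y = size ws, orb (y ++ p) &
    forall w, w \in ws -> ~ exists v, orb (v ++ y ++ p) /\ sim (v ++ y ++ p) w].
Proof.
elim: ws p => [|w ws IHws] p p_orb le_p le_ws; first by exists [::].
have le_Np : N <= size p by apply: leq_trans le_p.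
have [b bp_orb bNw] : exists2 b, orb (b :: p) & b \notin rereads p w.
  have : ~~ (left_exts p \subset rereads p w).
    apply/negP => sub_p; have := rho_lt.
    rewrite -(card_left_exts_stable p_orb le_Np) => lt_rho.
    have /card_gt0P[b b_left] : 0 < #|left_exts p| by apply: leq_ltn_trans lt_rho.
    have /rereadsP[v [v_orb simv]] := subsetP sub_p _ b_left.
    have card_R : #|rereads p w| = rho.
      apply: (card_rereads_rho (v := v ++ [:: b])); rewrite -?catA //.
      apply: leq_trans (le_ws w (mem_head _ _)).
      by rewrite leq_add2l leq_addl.
    by move: lt_rho; rewrite ltnNge -card_R subset_leq_card.
  by case/subsetPn => b /left_extsP; exists b.
have [|||y [sz_y y_orb avoid]] := IHws (b :: p).
- by [].
- exact: leqW.
- move=> w' w'_ws; rewrite /= addnS -addSn; apply: le_ws.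
  by rewrite inE w'_ws orbT.
exists (rcons y b); rewrite cat_rcons size_rcons sz_y; split=> // w'.
rewrite inE => /predU1P[-> [v [v_orb simv]]|/avoid //].
case/negP: bNw; apply/rereadsP; exists (v ++ y); by rewrite -catA.
Qed.

(** The words X' and Y' are loops at p. A word over X and Y is what remains of
the corresponding path when the leftmost p is removed from it, so it lies in the
part of the path that [sim] compares up to equivalence. *)
Lemma orb_loops_word X Y X' Y' p (w : seq bool) :
    N <= size p -> orb (X' ++ p) -> orb (Y' ++ p) ->
    X' ++ p = p ++ X -> Y' ++ p = p ++ Y ->
  orb (word X' Y' w ++ p) /\ word X' Y' w ++ p = p ++ word X Y w.
Proof.
move=> le_p X'p_orb Y'p_orb X'p Y'p; elim: w => [|b w [IHorb IHw]].
  by rewrite cats0; split; last by []; apply: orb_suffix X'p_orb.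
rewrite !word_cons -catA IHw; split.
  by case: b; apply: orb_glue; rewrite -?IHw.
by rewrite [LHS]catA; case: b; rewrite ?X'p ?Y'p -catA.
Qed.

(** The word x is arbitrary, of the length that [escape_threads] requires to
treat all words t x p with |t| = K; y escapes these. By [sim_local], a word
containing t x p is then never identified with one that contains y p at the
same place, whatever stands on both sides. Finally t x and y are extended to
the left until p comes back. *)
Lemma balanced_loops : exists X Y, forall v v' u : seq bool,
  perm_eq (rcons v true) (rcons v' false) ->
  ~ state_equiv M (word X Y (v ++ true :: u)) (word X Y (v' ++ false :: u)).
Proof.
have [p [sz_p p_orb p_rec]] := recurrent_orb le_N_n0.
have le_p : N <= size p by rewrite sz_p.
pose l := #|{: K.-tuple Q}|.
have [x [sz_x xp_orb]] := orb_extend l p_orb le_p.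
pose ws := [seq val t ++ x ++ p | t : K.-tuple Q <- enum {: K.-tuple Q}].
have sz_ws : size ws = l by rewrite size_map -cardE.
have [|w /mapP[t _ ->]|y [sz_y yp_orb avoid]] := @escape_threads ws p p_orb.
- by rewrite sz_p.
- by rewrite sz_ws !size_cat sz_x (size_tuple t).
have le_xp : N <= size (x ++ p) by rewrite size_cat (leq_trans le_p) ?leq_addl.
(* At least K letters must follow x in the first loop; t provides them. *)
have [t [sz_t txp_orb]] := orb_extend K xp_orb le_xp.
have loop z : orb (z ++ p) -> exists s r, orb ((s ++ z) ++ p) /\ (s ++ z) ++ p = p ++ r.
  move=> /p_rec[s [s_orb takes]]; exists s, (drop n0 (s ++ z ++ p)).
  by rewrite -catA -{3}takes cat_take_drop.
have [|s [X [X_orb loopX]]] := loop (t ++ x); first by rewrite -catA.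
have [s' [Y [Y_orb loopY]]] := loop y yp_orb.
exists X, Y => v v' u perm_v equiv_w.
have [_ eq_w] := orb_loops_word (v ++ true :: u) le_p X_orb Y_orb loopX loopY.
have [w_orb _] := orb_loops_word (v ++ true :: u) le_p X_orb Y_orb loopX loopY.
have [w'_orb eq_w'] := orb_loops_word (v' ++ false :: u) le_p X_orb Y_orb loopX loopY.
have [_ eq_u] := orb_loops_word u le_p X_orb Y_orb loopX loopY.
have sim_w : sim (p ++ word X Y (v' ++ false :: u)) (p ++ word X Y (v ++ true :: u)).
  split; first 1 last.
  - by rewrite !takel_cat.
  - have /eqP sub0 : N - size p == 0 by rewrite subn_eq0.
    rewrite !drop_cat sub0 !drop0; case: ifP => _; last exact: state_equiv_sym.
    by apply: state_equiv_cat; last exact: state_equiv_sym.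
  have : perm_eq (v ++ true :: u) (v' ++ false :: u).
    by rewrite -!cat_rcons perm_cat2r.
  move=> /(perm_map (fun b : bool => if b then X else Y))/perm_flatten/perm_size.
  by rewrite !size_cat => ->.
move: sim_w w_orb w'_orb; rewrite -eq_w -eq_w' !word_cat !word_cons -!catA eq_u.
set v1 := word _ _ v; set v2 := word _ _ v'; set z := word X Y u.
move=> sim_w w_orb w'_orb.
have [|||||||v3 [v3_orb sim3]] :=
    @sim_local y p (t ++ x ++ p) (t ++ x) (v1 ++ s) z (v2 ++ s').
- by rewrite sz_p.
- by rewrite !size_cat sz_t sz_x sz_y sz_ws.
- by rewrite -catA.
- by rewrite -catA; apply: sim_refl.
- by rewrite -!catA.
- by rewrite -!catA.
- by rewrite -!catA.
have /avoid[] : t ++ x ++ p \in ws; last by exists v3.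
have sz_t' : size t == K by rewrite sz_t.
by apply/mapP; exists (Tuple sz_t'); rewrite ?mem_enum.
Qed.

End Threads.

End FiniteType.

Lemma balanced_loops_of_infinite_order :
    (forall m n, 0 < m -> 0 < n ->
       state_equiv M (nseq m q) (nseq n q) -> m = n) ->
  exists X Y, forall v v' u : seq bool, perm_eq (rcons v true) (rcons v' false) ->
    ~ state_equiv M (word X Y (v ++ true :: u)) (word X Y (v' ++ false :: u)).
Proof.
move=> q_inf; have [N stableN] := left_exts_stabilise.
have [K [n0 [rho [le_N card_rho]]]] := card_rereads_stabilise stableN.
have [rho_lt|rho_ge] := ltnP rho #|left_exts (nseq N q)|.
  exact: (balanced_loops stableN le_N card_rho rho_lt).
have [m [n [m_gt0 n_gt0 neq_mn equiv_mn]]] := powers_equiv stableN le_N card_rho rho_ge.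
by case: neq_mn; apply: q_inf.
Qed.

End Orbit.

(** * The automaton semigroup *)

Section Quotient.

Variables (Q A : finType) (M : mealy Q A).

Lemma prod_as_class (X Y : seq Q) (w : seq bool) :
  (\prod_(b <- w) (if b then as_class M X else as_class M Y))%g
    = as_class M (word X Y w).
Proof.
elim: w => [|b w IHw]; first by rewrite big_nil.
rewrite big_cons IHw word_cons -[LHS]/(as_mul _ _).
by case: b; rewrite as_mulE.
Qed.

Lemma exp_as_class s n :
  (as_class M s ^+ n)%g = as_class M (flatten (nseq n s)).
Proof.
elim: n => [|n IHn]; first by rewrite expg0.
by rewrite expgS IHn -[LHS]/(as_mul _ _) as_mulE.
Qed.

End Quotient.

Lemma infinite_order_of_free (G : monoidType) (x y : G) :
  freely_generate x y -> infinite_order x.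
Proof.
move=> free_xy m n m_gt0 n_gt0 eq_x.
have prod_nseq k : (\prod_(b <- nseq k true) (if b then x else y))%g = (x ^+ k)%g.
  by elim: k => [|k IHk]; rewrite ?big_nil ?expg0 //= big_cons IHk expgS.
have := free_xy (nseq m true) (nseq n true); rewrite !prod_nseq eq_x.
case: m n m_gt0 n_gt0 {eq_x} => [|m] [|n] // _ _ /(_ isT isT erefl).
by move=> /(congr1 size); rewrite /= !size_nseq.
Qed.

Theorem theorem1p1 (Q A : finType) (M : mealy Q A) (hM : reversible M) :
  contains_nonabelian_free_subsemigroup (automaton_semigroup M) <->
  exists x : automaton_semigroup M, infinite_order x.
Proof.
split=> [[x [y /infinite_order_of_free x_inf]]|[g g_inf]]; first by exists x.
(* In the power automaton the word s is a single letter. *)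
pose s := repr g; pose P := power_mealy M (size s); pose q := in_tuple s.
have equivP t t' : state_equiv P t t' <->
    as_class M (flatten (map val t)) = as_class M (flatten (map val t')).
  by split=> [tt|/as_classP tt u]; [apply/as_classP => u|];
     move: (tt u); rewrite ?dot_power.
have powq n : as_class M (flatten (map val (nseq n q))) = (g ^+ n)%g.
  by rewrite map_nseq -exp_as_class as_class_repr.
have [m n m_gt0 n_gt0 /equivP|X [Y balanced]] :=
    @balanced_loops_of_infinite_order _ _ P q (power_reversible hM _).
  by rewrite !powq; apply: g_inf.
pose val_word (Z : seq ((size s).-tuple Q)) : seq Q := flatten (map val Z).
have val_wordE w : val_word (word X Y w) =
    word (val_word X) (val_word Y) w.
  elim: w => // b w IHw; rewrite !word_cons -IHw /val_word map_cat flatten_cat.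
  by case: b.
exists (as_class M (val_word X)), (as_class M (val_word Y)).
apply: free_of_balanced_injective => v v' u /balanced neq.
by rewrite !prod_as_class -!val_wordE => /equivP/neq.
Qed.
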